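(* The linearization, as a first-order linear system on $\mathbb{R}^{16}$ in the variables $(x,\dot x)$, of the rotating 4-body equations $$\ddot{x}_i=2\omega J\dot{x}_i+\omega^2 x_i+\sum_{j\ne i}\frac{x_j-x_i}{|x_j-x_i|^3},\qquad i=1,\dots,4,\qquad \omega>0,\ \ \omega^2=\frac{\sqrt2}{16}+\frac1{32},$$ at the equilibrium $x_1=(2,0)$, $x_2=(0,2)$, $x_3=(-2,0)$, $x_4=(0,-2)$, $\dot x=0$, has, counted with multiplicity, the following sixteen eigenvalues: (i) $0,\ 0,\ \pm\frac{\sqrt{2+4\sqrt2}}{8}\,i$; (ii) $\pm\frac18\sqrt{\,i\sqrt{68\sqrt2-9}-2\sqrt2-1}$ and $\pm\frac18\sqrt{-i\sqrt{68\sqrt2-9}-2\sqrt2-1}$; (iii) $\frac{\sqrt{2+4\sqrt2}}{8}\,i$ (twice) and $-\frac{\sqrt{2+4\sqrt2}}{8}\,i$ (twice); (iv) $\pm\frac{2^{1/4}}{4}+\frac{\sqrt{2+4\sqrt2}}{8}\,i$ and $\pm\frac{2^{1/4}}{4}-\frac{\sqrt{2+4\sqrt2}}{8}\,i$. The eight eigenvalues in (ii) and (iv) have nonzero real part, and the relative equilibrium given by the square configuration is unstable. The elliptic direction has dimension $6$, i.e. there are exactly six nonzero purely imaginary eigenvalues counted with multiplicity.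
   Context: This is the planar Newtonian 4-body problem with four masses equal to $1$, $x_i\in\mathbb{R}^2$, $x=(x_1,\dots,x_4)\in\mathbb{R}^8$, and $J=\begin{pmatrix}0&1\\-1&0\end{pmatrix}$. The displayed equations are Newton's equations $\ddot q_i=\sum_{j\neq i}(q_j-q_i)/|q_j-q_i|^3$ written in uniformly rotating coordinates $q_i=\exp(-\omega Jt)x_i$. A relative equilibrium is a solution that is constant in such rotating coordinates; the square configuration $(2,0),(0,2),(-2,0),(0,-2)$ is an equilibrium of the rotating system for the given $\omega$. In (ii), $\pm\sqrt{w}$ denotes the two complex square roots of $w$. Stability refers to stability of this equilibrium for the rotating system. *)

(* Defs.v *)
From HB Require Import structures.
From mathcomp Require Import all_boot all_order all_algebra.
From mathcomp Require Import all_classical all_reals all_analysis.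
From mathcomp Require Import complex.

Set Implicit Arguments.
Unset Strict Implicit.
Unset Printing Implicit Defensive.

Import Order.TTheory GRing.Theory Num.Theory.
Import numFieldNormedType.Exports.

Local Open Scope classical_set_scope.
Local Open Scope ring_scope.

(* [z] is a solution on [0, +oo[ of the autonomous equation z' = F z that
   remains in the domain [D] of the vector field. *)
Definition forward_solution (R : realType) (V : normedModType R) (D : set V)
    (F : V -> V) (z : R -> V) : Prop :=
  [/\ {within `[0, +oo[, continuous z},
      forall t : R, 0 <= t -> D (z t)
    & forall t : R, 0 < t -> is_derive t (1 : R) z (F (z t))].

(* Lyapunov stability: solutions starting close enough to [p] are defined for
   all t >= 0 and remain in a prescribed neighbourhood of [p].  When [F] is
   locally Lipschitz on the open set [D], the solution with a given initial
   value is unique, so that "the solution" may be quantified existentially. *)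
Definition lyapunov_stable (R : realType) (V : normedModType R) (D : set V)
    (F : V -> V) (p : V) : Prop :=
  forall U : set V, nbhs p U ->
  exists2 W : set V, nbhs p W &
    forall z0, W z0 -> exists z : R -> V,
      [/\ forward_solution D F z, z 0 = z0 & forall t : R, 0 <= t -> U (z t)].

Definition unstable (R : realType) (V : normedModType R) (D : set V)
    (F : V -> V) (p : V) : Prop := ~ lyapunov_stable D F p.

(* The complex eigenvalues of the real matrix [A], listed with their algebraic
   multiplicities. *)
Definition has_eigenvalues (R : realType) (n : nat) (A : 'M[R]_n)
    (s : seq R[i]) : Prop :=
  char_poly (map_mx (real_complex R) A) = \prod_(l <- s) ('X - l%:P).

Definition purely_imaginary (R : realType) (l : R[i]) : bool :=
  complex.Re l == 0.

Definition eucl_norm (R : realType) (u : 'rV[R]_2) : R :=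
  Num.sqrt (\sum_k u 0 k ^+ 2).

(* The matrix (0, 1; -1, 0). *)
Definition Jmx (R : realType) : 'M[R]_2 := delta_mx 0 1 - delta_mx 1 0.

(* Positions and velocities of the bodies are the rows of 4 x 2 matrices.
   Since these are row vectors, J v is rendered as v *m J^T. *)
Definition accel (R : realType) (omega : R) (x v : 'M[R]_(4, 2)) :
    'M[R]_(4, 2) :=
  \matrix_(i < 4)
    ((2 * omega) *: (row i v *m (Jmx R)^T) + omega ^+ 2 *: row i x
     + \sum_(j < 4 | j != i)
         (eucl_norm (row j x - row i x) ^+ 3)^-1 *: (row j x - row i x)).

(* R^16, with coordinates (x_1, .., x_4, x_1', .., x_4'). *)
Notation phase R := 'rV[R]_(4 * 2 + 4 * 2).

Definition state (R : realType) (x v : 'M[R]_(4, 2)) : phase R :=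
  row_mx (mxvec x) (mxvec v).

Definition pos (R : realType) (z : phase R) : 'M[R]_(4, 2) :=
  vec_mx (lsubmx z).

Definition vel (R : realType) (z : phase R) : 'M[R]_(4, 2) :=
  vec_mx (rsubmx z).

Definition rotating_field (R : realType) (omega : R) (z : phase R) : phase R :=
  state (vel z) (accel omega (pos z) (vel z)).

Definition collision_free (R : realType) : set (phase R) :=
  [set z | forall i j : 'I_4, i != j -> row i (pos z) != row j (pos z)].

Definition square (R : realType) : 'M[R]_(4, 2) :=
  \matrix_(i < 4, j < 2)
    (nth [::] [:: [:: 2; 0]; [:: 0; 2]; [:: - 2; 0]; [:: 0; - 2]] i)`_j.

(* Main.v *)
Require Import Defs.
From HB Require Import structures.
From mathcomp Require Import all_boot all_order all_algebra.
From mathcomp Require Import all_classical all_reals all_analysis.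
From mathcomp Require Import complex.
From mathcomp Require Import ring lra.

Import Order.TTheory GRing.Theory Num.Theory.
Import numFieldNormedType.Exports.

Local Open Scope ring_scope.
Local Open Scope complex_scope.
Set Implicit Arguments.
Unset Strict Implicit.

(** Spectrum.  The Newtonian pull on a relative position [d] has derivative
    [|d|^-3 (1 - 3 d^T d / |d|^2)], so at a collision-free point the Jacobian of
    the rotating system is [block_mx 0 K 1 G], where [G] is the Coriolis matrix
    and [K] the linearized force, and its characteristic polynomial is
    [det (X^2 - X G - K)] ([char_poly_second_order]).  The square is invariant
    under the quarter turn combined with a cyclic shift of the bodies.  This
    symmetry has the four eigenvalues [t] with [t^4 = 1], each with a
    two-dimensional eigenspace, and the eigenspaces are stable under [K] and
    [G] ([restoring_mode], [modes_coriolis]).  The determinant therefore splits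
    into four 2 x 2 determinants, whose roots are:
    - [t = 1], homographic motions: [0, 0] and [+-mu], with [mu = omega i];
    - [t = -1]: the roots of [X^4 + omega^2 X^2 + 72 a b], where
      [a = sqrt 2 / 64] and [b = 1 / 64]; these are the eigenvalues [eigs_ii];
    - [t = +-i]: [(X -+ mu)^2 ((X +- mu)^2 - nu^2)], the double roots coming
      from the translations.

    Instability.  An eigenvalue with positive real part makes an equilibrium
    of any differentiable field unstable ([unstable_of_eigenvalue]).  The
    Jacobian [A] also has imaginary eigenvalues, so a rate [lam] is chosen
    between 0 and the real part, off the finitely many half-sums of
    eigenvalues.  Then the Lyapunov equation
    [A S + S A^T = 2 lam S + 1] has a symmetric solution [S]
    ([exists_growth_rate]), and the quadratic form [q] of [S] satisfies
    [q' >= 2 lam q] along every solution that stays near the equilibrium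
    ([quadratic_growth_near]).  The eigenvector forces [q] to be positive
    somewhere ([unstable_direction]); a solution starting there with small
    initial value has [q] growing at least like [exp (2 lam t)], so it leaves
    the neighbourhood. *)

(** * The Lyapunov equation *)

(** If [M] has no eigenvalue in common with [N], only 0 intertwines them: by
    Cayley-Hamilton the product of the [M - l] kills [S], and each factor
    crosses [S] to become the invertible [N - l]. *)
Lemma sylvester_eq0 (F : fieldType) n (M N S : 'M[F]_n) (s : seq F) :
  char_poly M = \prod_(l <- s) ('X - l%:P) ->
  (forall l, l \in s -> ~~ eigenvalue N l) ->
  M *m S = S *m N -> S = 0.
Proof.
case: n => [|n] in M N S *; first by rewrite [S]flatmx0.
move=> splitM eigN MS.
have := Cayley_Hamilton M; rewrite splitM rmorph_prod /= => CH.
have : (\prod_(l <- s) (M - l%:M)) *m S = 0.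
  rewrite -[RHS](mul0mx _ S) -CH; congr (_ *m S); apply: eq_bigr => l _.
  by rewrite rmorphB /= horner_mx_X horner_mx_C.
clear splitM CH; elim: s eigN => [|l s IHs] eigN.
  by rewrite big_nil mul1mx.
have prod_comm : M *m (\prod_(j <- s) (M - j%:M)) = (\prod_(j <- s) (M - j%:M)) *m M.
  apply: commr_prod => j _; rewrite /GRing.comm mulrBl mulrBr; congr (_ - _).
  exact: scalar_mxC.
rewrite big_cons -[_ * _]/(_ *m _) -mulmxA; set S' := _ *m S => S'0.
apply: IHs => [j js|]; first by apply: eigN; rewrite in_cons js orbT.
have S'N : M *m S' = S' *m N by rewrite /S' mulmxA prod_comm -!mulmxA MS.
have {}S'0 : S' *m (N - l%:M) = 0.
  by rewrite mulmxBr -S'N scalar_mxC -mulmxBl.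
have uN : N - l%:M \in unitmx.
  have := eigN l (mem_head _ _).
  by rewrite /eigenvalue /eigenspace negbK kermx_eq0 row_free_unit.
by rewrite -/S' -(mulmxK uN S') S'0 mul0mx.
Qed.

Lemma char_poly_tr (F : comNzRingType) n (M : 'M[F]_n) :
  char_poly M^T = char_poly M.
Proof.
rewrite /char_poly -[RHS]det_tr; congr (\det _).
by rewrite /char_poly_mx linearB /= tr_scalar_mx map_trmx.
Qed.

(** [S |-> M S + S M^T] is injective by [sylvester_eq0] applied to [M] and
    [- M^T], hence onto.  Symmetrizing a preimage of 1 keeps the equation. *)
Lemma exists_lyapunov_form (R : realType) n (M : 'M[R]_n) :
  (forall l l' : R[i], eigenvalue (map_mx (real_complex R) M) l ->
     eigenvalue (map_mx (real_complex R) M) l' -> l + l' != 0) ->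
  exists S : 'M[R]_n, S^T = S /\ M *m S + S *m M^T = 1%:M.
Proof.
move=> eig_sum.
pose Mc := map_mx (real_complex R) M.
pose L (S : 'M[R]_n) := M *m S + S *m M^T.
have linL : linear L.
  by move=> a S T; rewrite /L mulmxDr mulmxDl -scalemxAr -scalemxAl scalerDr addrACA.
pose LL := GRing.isLinear.Build _ _ _ _ _ linL.
pose Ll : {linear 'M[R]_n -> 'M[R]_n} := HB.pack L LL.
have L_inj S : L S = 0 -> S = 0.
  move=> /eqP; rewrite addr_eq0 => /eqP MS.
  apply: (@map_mx_inj _ _ (real_complex R)); rewrite map_mx0.
  have [s char_s] := closed_field_poly_normal (char_poly Mc).
  rewrite (monicP (char_poly_monic _)) scale1r in char_s.
  apply: (@sylvester_eq0 _ _ Mc (- Mc^T) _ s) => //; last first.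
    by rewrite /Mc -map_mxM MS map_mxN map_mxM -map_trmx mulmxN.
  move=> l ls; apply/negP => eigl.
  have : eigenvalue Mc (- l).
    rewrite eigenvalue_root_char -char_poly_tr -eigenvalue_root_char.
    have [v /eqP vM v0] := eigenvalueP eigl; apply/eigenvalueP; exists v => //.
    by move: vM; rewrite mulmxN eqr_oppLR -scaleNr => /eqP.
  have : eigenvalue Mc l by rewrite eigenvalue_root_char char_s root_prod_XsubC.
  by move=> /eig_sum h /h; rewrite subrr eqxx.
have uL : lin_mx Ll \in unitmx.
  rewrite -row_free_unit -kermx_eq0; apply/eqP/row_matrixP => i.
  rewrite row0; set u := row i _.
  have : u *m lin_mx Ll = 0 by rewrite /u -row_mul mulmx_ker row0.
  rewrite -[u]vec_mxK mul_vec_lin => /(canRL mxvecK); rewrite linear0.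
  by move=> /L_inj ->; rewrite linear0.
have [S0 LS0] : exists S, L S = 1%:M.
  exists (vec_mx (mxvec 1%:M *m invmx (lin_mx Ll))).
  by apply: (can_inj mxvecK); rewrite -[L _]/(Ll _) -mul_vec_lin vec_mxK mulmxKV.
exists ((1 / 2) *: (S0 + S0^T)); split.
  by rewrite linearZ linearD /= trmxK addrC.
rewrite -scalemxAl -scalemxAr -scalerDr mulmxDl mulmxDr addrACA.
have LS0T : M *m S0^T + S0^T *m M^T = 1%:M.
  by rewrite -[RHS]trmx1 -LS0 linearD /= !trmx_mul trmxK addrC.
rewrite LS0T [X in X + _]LS0 -mulr2n -[1%:M *+ 2]scaler_nat scalerA divfK.
  by rewrite scale1r.
by rewrite pnatr_eq0.
Qed.

Lemma exists_itv_notin (R : realType) (r : R) (s : seq R) :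
  0 < r -> exists2 x, 0 < x < r & x \notin s.
Proof.
move=> r0; pose t := [seq r / k.+2%:R | k <- iota 0 (size s).+1].
have [/hasP[x /mapP[k _ ->] xs]|/hasPn ts] := boolP (has (fun x => x \notin s) t).
  exists (r / k.+2%:R) => //.
  by rewrite divr_gt0 ?ltr0n //= ltr_pdivrMr ?ltr0n // ltr_pMr // ltr1n.
suff : (size t <= size s)%N by rewrite size_map size_iota ltnn.
apply: uniq_leq_size => [|x /ts]; last by rewrite negbK.
rewrite map_inj_uniq ?iota_uniq // => k k' /(mulfI (lt0r_neq0 r0)) /invr_inj.
by move=> /eqP; rewrite eqr_nat => /eqP[].
Qed.

(** The equation for [S] is the Lyapunov equation of [A - lam].  It is solvable
    as soon as [2 lam] is not a sum of two eigenvalues of [A], which leaves a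
    choice in any interval. *)
Lemma exists_growth_rate (R : realType) n (A : 'M[R]_n) (r : R) : 0 < r ->
  exists lam : R, 0 < lam < r /\
  exists S : 'M[R]_n, S^T = S /\ A *m S + S *m A^T = (2 * lam) *: S + 1%:M.
Proof.
move=> r0; pose Ac := map_mx (real_complex R) A.
have [s char_s] := closed_field_poly_normal (char_poly Ac).
rewrite (monicP (char_poly_monic _)) scale1r in char_s.
have [lam lam_r lam_s] :=
  exists_itv_notin [seq complex.Re (l + l') / 2 | l <- s, l' <- s] r0.
exists lam; split=> //.
have eigB l : eigenvalue (map_mx (real_complex R) (A - lam%:M)) l -> l + lam%:C \in s.
  move=> /eigenvalueP[v vA v0].
  rewrite -root_prod_XsubC -char_s -eigenvalue_root_char.
  apply/eigenvalueP; exists v => //; move: vA.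
  rewrite map_mxB map_scalar_mx mulmxBr mul_mx_scalar => /eqP.
  by rewrite subr_eq => /eqP; rewrite -scalerDl.
have [S [ST LS]] : exists S : 'M[R]_n,
    S^T = S /\ (A - lam%:M) *m S + S *m (A - lam%:M)^T = 1%:M.
  apply: exists_lyapunov_form => l l' /eigB ls /eigB l's.
  apply/negP => /eqP ll'; move/negP: lam_s; apply; apply/allpairsP.
  exists (l + lam%:C, l' + lam%:C); split => //=.
  by rewrite addrACA ll' add0r /=; lra.
exists S; split=> //; rewrite -LS linearB /= tr_scalar_mx mulmxBl mulmxBr.
rewrite mul_scalar_mx mul_mx_scalar mulr_natl mulr2n scalerDl.
move: (A *m S) (S *m A^T) (lam *: S) => X Y Z.
by apply/matrixP => i j; rewrite !mxE; ring.
Qed.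

(** * Quadratic growth and instability *)

Definition bilform (R : realType) n (S : 'M[R]_n) (y z : 'rV[R]_n) : R :=
  (y *m S *m z^T) 0 0.

Lemma bilformE (R : realType) n (S : 'M[R]_n) (y z : 'rV[R]_n) :
  bilform S y z = \sum_j \sum_i S i j * (y 0 i * z 0 j).
Proof.
rewrite /bilform mxE; apply: eq_bigr => j _; rewrite !mxE mulr_suml.
by apply: eq_bigr => i _; rewrite mulrA [S i j * _]mulrC.
Qed.

Lemma bilformC (R : realType) n (S : 'M[R]_n) (y z : 'rV[R]_n) :
  S^T = S -> bilform S y z = bilform S z y.
Proof.
move=> ST; rewrite /bilform -[in RHS]ST.
by rewrite -[in RHS](trmxK z) -mulmxA -!trmx_mul mulmxA [RHS]mxE.
Qed.

Lemma coord_le_norm (R : realType) n (y : 'rV[R]_n) i : `|y 0 i| <= `|y|.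
Proof.
rewrite [leRHS]/Num.Def.normr/= mx_normrE.
exact: (le_bigmax _ (fun k : 'I_1 * 'I_n => `|y k.1 k.2|) (0, i)).
Qed.

Lemma bilform_bound (R : realType) n (S : 'M[R]_n) :
  exists2 K, 0 < K & forall y z, `|bilform S y z| <= K * `|y| * `|z|.
Proof.
exists (1 + \sum_j \sum_i `|S i j|).
  by rewrite ltr_pwDl // sumr_ge0 // => j _; rewrite sumr_ge0.
move=> y z; rewrite bilformE -mulrA mulrDl mul1r.
apply: le_trans (_ : _ <= (\sum_j \sum_i `|S i j|) * (`|y| * `|z|)) _; last first.
  by rewrite lerDr mulr_ge0.
rewrite mulr_suml (le_trans (ler_norm_sum _ _ _)) // ler_sum // => j _.
rewrite mulr_suml (le_trans (ler_norm_sum _ _ _)) // ler_sum // => i _.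
by rewrite normrM ler_wpM2l // normrM ler_pM // coord_le_norm.
Qed.

(** The norm of a row vector is the maximum norm, so only an inequality holds. *)
Lemma sqr_norm_le_dot (R : realType) n (y : 'rV[R]_n) :
  `|y| ^+ 2 <= bilform 1%:M y y.
Proof.
have dotE : bilform 1%:M y y = \sum_j y 0 j ^+ 2.
  by rewrite /bilform mulmx1 mxE; apply: eq_bigr => j _; rewrite mxE expr2.
rewrite dotE; have [->|y0] := eqVneq `|y| 0.
  by rewrite expr0n sumr_ge0 // => j _; rewrite sqr_ge0.
have [[i j] /= eqy] := mx_norm_neq0 y0; rewrite ord1 in eqy.
rewrite [`|y|]eqy -normrX ger0_norm ?sqr_ge0 // (bigD1 j) //= lerDl.
by rewrite sumr_ge0 // => k _; rewrite sqr_ge0.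
Qed.

Lemma is_derive_coord (R : realType) n (z : R -> 'rV[R]_n) (t : R) dz i :
  is_derive t 1 z dz -> is_derive t (1 : R) (fun u => z u 0 i : R) (dz 0 i).
Proof.
move=> [dfz <-]; apply: DeriveDef; first exact: (derivable_mxP z t 1).1.
by rewrite derive_mx // mxE.
Qed.

Lemma is_derive_bilform (R : realType) n (S : 'M[R]_n) (z : R -> 'rV[R]_n) (t : R) dz :
  S^T = S -> is_derive t 1 z dz ->
  is_derive t (1 : R) (fun u => bilform S (z u) (z u)) (2 * bilform S dz (z t)).
Proof.
move=> ST dz_z.
have -> : (fun u => bilform S (z u) (z u)) =
    \sum_j \sum_i S i j *: ((fun u => z u 0 i) * (fun u => z u 0 j)).
  rewrite funeqE => u; rewrite bilformE fct_sumE; apply: eq_bigr => j _.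
  by rewrite fct_sumE.
have zc i := is_derive_coord i dz_z.
apply: is_derive_eq; rewrite mulr_natl mulr2n {2}bilformC // !bilformE.
rewrite -big_split; apply: eq_bigr => j _; rewrite -big_split.
by apply: eq_bigr => i _; rewrite /= -mulrDr /GRing.scale /=; congr (_ * _); ring.
Qed.

Lemma continuous_bilform (R : realType) n (S : 'M[R]_n) :
  continuous (fun y : 'rV[R]_n => bilform S y y : R).
Proof.
have -> : (fun y : 'rV[R]_n => bilform S y y) =
    \sum_j \sum_i (fun y : 'rV[R]_n => S i j * (y 0 i * y 0 j)).
  rewrite funeqE => u; rewrite bilformE fct_sumE; apply: eq_bigr => j _.
  by rewrite fct_sumE.
move=> y.
apply: (big_ind (fun f : 'rV[R]_n -> R => {for y, continuous f})) => [|f g cf cg|j _].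
- exact: cst_continuous.
- exact: continuousD.
apply: (big_ind (fun f : 'rV[R]_n -> R => {for y, continuous f})) => [|f g cf cg|i _].
- exact: cst_continuous.
- exact: continuousD.
apply: continuousM; first exact: cst_continuous.
by apply: continuousM; exact: coord_continuous.
Qed.

Lemma bilformDl (R : realType) n (S : 'M[R]_n) y y' z :
  bilform S (y + y') z = bilform S y z + bilform S y' z.
Proof. by rewrite /bilform !mulmxDl mxE. Qed.

Lemma bilform_lyapunov (R : realType) n (A S : 'M[R]_n) (lam : R) y :
  S^T = S -> A *m S + S *m A^T = (2 * lam) *: S + 1%:M ->
  2 * bilform S (y *m A) y = 2 * lam * bilform S y y + bilform 1%:M y y.
Proof.
move=> ST AS.
have -> : 2 * lam * bilform S y y + bilform 1%:M y y = bilform (A *m S + S *m A^T) y y.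
  rewrite AS /bilform mulmxDr mulmxDl -scalemxAr -scalemxAl [RHS]mxE.
  by rewrite [X in _ = X + _]mxE.
rewrite mulr_natl mulr2n {2}bilformC // /bilform trmx_mul !mulmxA.
by rewrite mulmxDr mulmxDl [RHS]mxE !mulmxA.
Qed.

(** The identity matrix in the Lyapunov equation provides a positive term in
    [|z - p|^2], which absorbs the remainder of the first-order expansion of
    [F] at [p]. *)
Lemma quadratic_growth_near (R : realType) n (F : 'rV[R]_n -> 'rV[R]_n) p
    (S : 'M[R]_n) (lam : R) :
  F p = 0 -> differentiable F p -> S^T = S ->
  jacobian F p *m S + S *m (jacobian F p)^T = (2 * lam) *: S + 1%:M ->
  exists2 d, 0 < d & forall z, `|z - p| < d ->
    2 * lam * bilform S (z - p) (z - p) <= 2 * bilform S (F z) (z - p).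
Proof.
move=> Fp0 dF ST AS; have [K K0 bK] := bilform_bound S.
(* With a remainder below |y| / (2 K), its contribution to the derivative is at
   most |y|^2. *)
have /eqaddoP/(_ (1 / (2 * K))) := diff_locally dF.
have e0 : 0 < 1 / (2 * K) by rewrite divr_gt0 // mulr_gt0.
move=> /(_ e0) /nbhs_ballP[d d0 dP]; exists d => // z; set y := z - p => yd.
have {dP} := dP y; rewrite -ball_normE /= sub0r normrN => /(_ yd).
rewrite !fctE /= subrK Fp0 add0r; set r := F z - _ => rle.
have -> : F z = y *m jacobian F p + r.
  by rewrite /jacobian mul_rV_lin1 /r addrC subrK.
rewrite (bilformDl _ (y *m _)) mulrDr (bilform_lyapunov _ ST AS) -addrA lerDl.
have := bK r y; have := sqr_norm_le_dot y.
have : K * `|r| * `|y| <= `|y| ^+ 2 / 2.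
  have := ler_wpM2r (normr_ge0 y) (ler_wpM2l (ltW K0) rle).
  by congr (_ <= _); field; rewrite lt0r_neq0.
have := ler_norm (- bilform S r y); rewrite normrN; lra.
Qed.

(** Let [a + i b] be a (row) eigenvector for [l], with [a] and [b] real.  Adding
    the Lyapunov identities at [a] and [b], the terms in [Im l] cancel because
    [S] is symmetric, and what remains is
    [2 (Re l - lam) (q a + q b) = |a|^2 + |b|^2 > 0]. *)
Lemma unstable_direction (R : realType) n (A S : 'M[R]_n) (lam : R) (l : R[i]) :
  S^T = S -> A *m S + S *m A^T = (2 * lam) *: S + 1%:M ->
  eigenvalue (map_mx (real_complex R) A) l -> 0 < lam < complex.Re l ->
  exists v, 0 < bilform S v v.
Proof.
move=> ST AS /eigenvalueP[w wA w0] /andP[lam0 laml].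
pose a : 'rV[R]_n := map_mx (@complex.Re R) w.
pose b : 'rV[R]_n := map_mx (@complex.Im R) w.
have mulRe (u : 'rV[R[i]]_n) : map_mx (@complex.Re R) (u *m map_mx (real_complex R) A) =
    map_mx (@complex.Re R) u *m A.
  apply/rowP => j; rewrite !mxE raddf_sum; apply: eq_bigr => i _.
  by rewrite !mxE; case: (u 0 i) => x y /=; rewrite mulr0 subr0.
have mulIm (u : 'rV[R[i]]_n) : map_mx (@complex.Im R) (u *m map_mx (real_complex R) A) =
    map_mx (@complex.Im R) u *m A.
  apply/rowP => j; rewrite !mxE raddf_sum; apply: eq_bigr => i _.
  by rewrite !mxE; case: (u 0 i) => x y /=; rewrite mulr0 add0r.
have aA : a *m A = complex.Re l *: a - complex.Im l *: b.
  rewrite -mulRe wA; apply/rowP => j; rewrite !mxE.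
  by case: l {wA laml} (w 0 j) => x y [x' y'].
have bA : b *m A = complex.Im l *: a + complex.Re l *: b.
  rewrite -mulIm wA; apply/rowP => j; rewrite !mxE.
  by case: l {wA laml aA} (w 0 j) => x y [x' y'] /=; rewrite addrC.
have bilZ (k : R) y z : bilform S (k *: y) z = k * bilform S y z.
  by rewrite /bilform -!scalemxAl mxE.
have := bilform_lyapunov a ST AS; have := bilform_lyapunov b ST AS.
rewrite aA bA !bilformDl -scaleNr !bilZ (bilformC b a ST).
have := sqr_norm_le_dot a; have := sqr_norm_le_dot b.
have ab0 : 0 < `|a| ^+ 2 + `|b| ^+ 2.
  rewrite lt0r paddr_eq0 ?sqr_ge0 // !sqrf_eq0 !normr_eq0 addr_ge0 ?sqr_ge0 // andbT.
  apply: contra w0 => /andP[/eqP a0 /eqP b0]; apply/eqP/rowP => j.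
  have := congr1 (fun u : 'rV_n => u 0 j) a0; have := congr1 (fun u : 'rV_n => u 0 j) b0.
  by rewrite !mxE; case: (w 0 j) => x y /= -> ->.
move=> lea leb eqa eqb.
have [qa|qa] := ltP 0 (bilform S a a); first by exists a.
exists b; rewrite ltNge; apply/negP => qb.
have : 0 < 2 * (complex.Re l - lam) * (bilform S a a + bilform S b b) by lra.
by apply/negP; rewrite -leNgt mulr_ge0_le0 //; lra.
Qed.

(** Lyapunov's theorem on instability in the first approximation. *)
Lemma unstable_of_eigenvalue (R : realType) n (D : set 'rV[R]_n)
    (F : 'rV[R]_n -> 'rV[R]_n) (p : 'rV[R]_n) (l : R[i]) :
  F p = 0 -> differentiable F p ->
  eigenvalue (map_mx (real_complex R) (jacobian F p)) l ->
  0 < complex.Re l -> unstable D F p.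
Proof.
move=> Fp0 dF eigl rel stab.
have [lam [lam_l [S [ST AS]]]] := exists_growth_rate (jacobian F p) rel.
have lam0 : 0 < lam by case/andP: lam_l.
have [v qv] := unstable_direction ST AS eigl lam_l.
have [d d0 growth] := quadratic_growth_near Fp0 dF ST AS.
have [K K0 bK] := bilform_bound S.
have [W Wp W_stab] := stab _ (nbhsx_ballx p d d0).
have [s s0 Wps] : exists2 s : R, 0 < s & W (p + s *: v).
  move: Wp => /nbhs_ballP[e /= e0 eW].
  exists (e / (2 * (`|v| + 1))); first by rewrite divr_gt0 // mulr_gt0 // ltr_wpDl.
  apply: eW; rewrite -ball_normE /= opprD addrA subrr add0r normrN normrZ.
  rewrite gtr0_norm ?divr_gt0 ?mulr_gt0 ?ltr_wpDl //.
  rewrite mulrAC ltr_pdivrMr ?mulr_gt0 ?ltr_wpDl // ltr_pM2l //.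
  by have := normr_ge0 v; lra.
have [z [[cz _ dz] z0 zU]] := W_stab _ Wps.
have zd t : 0 <= t -> `|z t - p| < d.
  by move=> /zU; rewrite -ball_normE /= distrC.
pose q t := bilform S (z t - p) (z t - p).
(* g is positive at 0 and nondecreasing, but a bounded q would make it tend
   to 0. *)
pose g := ((fun t => expR (- (2 * lam) * t)) * q)%R.
have q_der (t : R) : 0 < t -> is_derive t (1 : R) q (2 * bilform S (F (z t)) (z t - p)).
  move=> t0; have dzt := dz t t0.
  have := @is_derive_bilform _ _ S (fun u => z u - p) t (F (z t)) ST; apply.
  by rewrite -[F (z t)]subr0; apply: is_deriveB.
have e_der (t : R) : is_derive t (1 : R) (fun t => expR (- (2 * lam) * t))
    (- (2 * lam) * expR (- (2 * lam) * t)).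
  have d_lin : is_derive t (1 : R) (fun t => - (2 * lam) * t) (- (2 * lam)).
    have -> : (fun t => - (2 * lam) * t) = (- (2 * lam)) *: (id : R -> R) by [].
    by apply: is_derive_eq; rewrite /GRing.scale /= mulr1.
  have := @is_derive1_comp _ expR _ t _ _ (is_derive_expR _) d_lin.
  by rewrite [_ * - (2 * lam)]mulrC.
have g_der (t : R) : 0 < t -> is_derive t (1 : R) g
    (expR (- (2 * lam) * t) * (2 * bilform S (F (z t)) (z t - p) - 2 * lam * q t)).
  move=> t0; have := q_der t t0; have := e_der t => de dq.
  by apply: is_derive_eq; rewrite /GRing.scale /=; ring.
have g_mono : forall x y : R, 0 <= x -> x <= y -> g x <= g y.
  apply: ger0_derive1_ndecry => [x|x|].
  - by rewrite in_itv /= andbT => /g_der[].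
  - rewrite in_itv /= andbT => x0; have [_ g'x] := g_der x x0.
    rewrite derive1E g'x; rewrite mulr_ge0 ?expR_ge0 // subr_ge0.
    by apply: growth; exact/zd/ltW.
  - move=> x; apply: continuousM.
      apply: continuous_subspaceT => t.
      have [+ _] := e_der t.
      by move=> /derivable1_diffP/differentiable_continuous.
    have cy : {for x, continuous
        ((fun t => z t - p) : subspace `[0 : R, +oo[%classic -> 'rV[R]_n)}.
      by apply: continuousB; [exact: cz|exact: cst_continuous].
    exact: (continuous_comp cy (@continuous_bilform _ _ S _)).
have q0 : 0 < q 0.
  rewrite /q z0 addrC addKr /bilform linearZ /= -scalemxAr -!scalemxAl.
  by rewrite [ltRHS]mxE pmulr_rgt0 // [ltRHS]mxE pmulr_rgt0.
have q_bound t : 0 <= t -> q t <= K * d ^+ 2.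
  move=> t0; have ztd := zd t t0.
  apply: le_trans (ler_norm _) _; apply: le_trans (bK _ _) _.
  by rewrite expr2 mulrA ler_pM ?mulr_ge0 ?(ltW K0) // ?ler_wpM2l // ltW.
pose T := K * d ^+ 2 / (2 * lam * q 0).
have T0 : 0 <= T by rewrite divr_ge0 ?mulr_ge0 ?sqr_ge0 // ?ltW.
have := g_mono 0 T (lexx _) T0.
rewrite /g !fctE mulr0 expR0 mul1r mulNr expRN mulrC ler_pdivlMr ?expR_gt0 //.
apply/negP; rewrite -ltNge (le_lt_trans (q_bound T T0)) //.
apply: lt_le_trans (_ : q 0 * (1 + 2 * lam * T) <= _); last first.
  by rewrite ler_pM2l // expR_ge1Dx.
rewrite mulrDr mulr1 -[X in X < _]add0r ltr_leD // /T.
by rewrite le_eqVlt; apply/orP; left; apply/eqP; field; rewrite !lt0r_neq0.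
Qed.

(** * The derivative of the rotating field *)

Lemma is_diff_bigsum (R : realType) (V W : normedModType R) (I : Type) (r : seq I)
    (P : pred I) (f df : I -> V -> W) (x : V) :
  (forall i, P i -> is_diff x (f i) (df i)) ->
  is_diff x (\sum_(i <- r | P i) f i) (\sum_(i <- r | P i) df i).
Proof.
move=> dfi; apply: (big_ind2 (fun f df : V -> W => is_diff x f df)) => //.
  exact: is_diff_cst.
by move=> f1 df1 f2 df2; apply: is_diffD.
Qed.

Lemma is_diff_mx (R : realType) (V : normedModType R) m n
    (f df : V -> 'M[R]_(m, n)) (x : V) :
  (forall i j, is_diff x (fun z => f z i j : R) (fun h => df h i j)) ->
  is_diff x f df.
Proof.
move=> dfij.
have deltaE (g : V -> 'M[R]_(m, n)) :
    g = \sum_i \sum_j (fun z => g z i j *: delta_mx i j).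
  rewrite funeqE => z; rewrite fct_sumE [LHS]matrix_sum_delta.
  by apply: eq_bigr => i _; rewrite fct_sumE.
rewrite [f]deltaE [df]deltaE.
apply: is_diff_bigsum => i _; apply: is_diff_bigsum => j _.
have [d1 d2] := dfij i j; apply: DiffDef; first exact: differentiableZl.
by rewrite diffZl // d2.
Qed.

Lemma is_diff_coord (R : realType) m n (M : 'M[R]_(m, n)) i j :
  is_diff M (fun N : 'M[R]_(m, n) => N i j : R) (fun N => N i j).
Proof.
apply: DiffDef; first exact: differentiable_coord.
have coordl : linear (fun N : 'M[R]_(m, n) => N i j : R^o).
  by move=> a x v; rewrite !mxE.
pose cL := GRing.isLinear.Build _ _ _ _ _ coordl.
pose c : {linear 'M[R]_(m, n) -> R^o} :=
  HB.pack (fun N : 'M[R]_(m, n) => N i j : R^o) cL.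
by apply: (@diff_lin _ _ _ c); exact: coord_continuous.
Qed.

Lemma is_diff_entry (R : realType) (V : normedModType R) m n
    (f df : V -> 'M[R]_(m, n)) (x : V) i j :
  is_diff x f df -> is_diff x (fun z => f z i j : R) (fun h => df h i j).
Proof. by move=> dfx; exact: is_diff_comp dfx (is_diff_coord (f x) i j). Qed.

Lemma is_diff_linear (R : realType) m n m' n'
    (f : 'M[R]_(m, n) -> 'M[R]_(m', n')) x : linear f -> is_diff x f f.
Proof.
move=> linf; apply: is_diff_mx => k l.
have -> : (fun z => f z k l) =
    \sum_i \sum_j (f (delta_mx i j) k l *: fun z : 'M[R]_(m, n) => z i j : R).
  pose fL := GRing.isLinear.Build _ _ _ _ _ linf.
  pose g : {linear 'M[R]_(m, n) -> 'M[R]_(m', n')} := HB.pack f fL.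
  rewrite funeqE => z; rewrite -[f z]/(g z) {1}[z]matrix_sum_delta.
  rewrite fct_sumE linear_sum summxE; apply: eq_bigr => i _.
  rewrite fct_sumE linear_sum summxE; apply: eq_bigr => j _.
  by rewrite linearZ mxE mulrC.
apply: is_diff_bigsum => i _; apply: is_diff_bigsum => j _; apply: is_diffZ.
exact: is_diff_coord.
Qed.

Lemma is_diff_real (R : realType) (f : R -> R) (a b : R) :
  is_derive a (1 : R) f b -> is_diff a f (fun h => h * b).
Proof.
move=> [df db]; apply: DiffDef; first exact/derivable1_diffP.
by rewrite deriv1E // derive1E db.
Qed.

Lemma is_diff_inv (R : realType) (a : R) : a != 0 ->
  is_diff a (GRing.inv : R -> R) (fun h : R => - a ^- 2 *: h).
Proof.
by move=> a0; apply: DiffDef; [exact: differentiable_Rinv|exact: diff_Rinv].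
Qed.

Definition gravity (R : realType) (u : 'rV[R]_2) : 'rV[R]_2 :=
  (eucl_norm u ^+ 3)^-1 *: u.

(** The derivative of [gravity] at [u], as a symmetric matrix acting on row
    vectors: the tidal tensor of a unit point mass. *)
Definition tidal (R : realType) (u : 'rV[R]_2) : 'M[R]_2 :=
  (eucl_norm u ^+ 3)^-1 *: (1%:M - (3 / eucl_norm u ^+ 2) *: (u^T *m u)).

Lemma eucl_norm_gt0 (R : realType) (u : 'rV[R]_2) : u != 0 -> 0 < eucl_norm u.
Proof.
move=> u0; rewrite sqrtr_gt0 lt0r sumr_ge0 ?andbT => [|k _]; last exact: sqr_ge0.
apply: contra u0 => /eqP/psumr_eq0P u0; apply/eqP/rowP => k; rewrite mxE.
by apply/eqP; rewrite -sqrf_eq0 u0 // => i _; exact: sqr_ge0.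
Qed.

Lemma is_diff_eucl_norm (R : realType) (u : 'rV[R]_2) : u != 0 ->
  is_diff u (@eucl_norm R) (fun h => (eucl_norm u)^-1 * (\sum_k u 0 k * h 0 k)).
Proof.
move=> /eucl_norm_gt0; rewrite /eucl_norm sqrtr_gt0 => s0.
have sq : is_diff u (\sum_k (fun v : 'rV[R]_2 => v 0 k) ^+ 2)
    (\sum_k 2%:R * u 0 k ^+ 1 *: (fun h : 'rV[R]_2 => h 0 k)).
  by apply: is_diff_bigsum => k _; have := is_diff_coord u 0 k => dk; exact: is_diffX.
have sE v : (\sum_k (fun v : 'rV[R]_2 => v 0 k) ^+ 2) v = \sum_k v 0 k ^+ 2.
  by rewrite fct_sumE.
have -> : (fun v : 'rV[R]_2 => Num.sqrt (\sum_k v 0 k ^+ 2)) =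
    Num.sqrt \o (\sum_k (fun v : 'rV[R]_2 => v 0 k) ^+ 2).
  by rewrite funeqE => v /=; rewrite sE.
have rt := is_diff_real (is_derive1_sqrt s0).
rewrite -sE in rt; apply: (is_diff_eq (is_diff_comp sq rt)).
rewrite funeqE => h /=; rewrite sE fct_sumE mulrC invfM (mulrC 2^-1) -mulrA.
congr (_ * _).
rewrite mulr_sumr; apply: eq_bigr => k _.
rewrite -[(_ *: _) h]/(2 * u 0 k * h 0 k); by field.
Qed.

Lemma is_diff_gravity (R : realType) (u : 'rV[R]_2) : u != 0 ->
  is_diff u (@gravity R) (fun h => h *m tidal u).
Proof.
move=> u0; have N0 := eucl_norm_gt0 u0; have dN := is_diff_eucl_norm u0.
apply: is_diff_mx => i l; rewrite ord1.
have dinv : is_diff u (fun v : 'rV[R]_2 => (eucl_norm v ^+ 3)^-1)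
    (fun h => - (3 / eucl_norm u ^+ 5) * (\sum_k u 0 k * h 0 k)).
  have dN3 := @is_diffX _ _ _ _ 2 _ dN.
  have N3 : (@eucl_norm R ^+ 3) u != 0 by rewrite exprfctE expf_neq0 // gt_eqF.
  have di := is_diff_inv N3.
  have -> : (fun v : 'rV[R]_2 => (eucl_norm v ^+ 3)^-1) =
      GRing.inv \o (@eucl_norm R ^+ 3).
    by rewrite funeqE => v /=; rewrite exprfctE.
  apply: (is_diff_eq (is_diff_comp dN3 di)); rewrite funeqE => h.
  rewrite /= !fctE /GRing.scale /=; field; exact: lt0r_neq0.
have dl := is_diff_coord u 0 l.
have -> : (fun z : 'rV[R]_2 => gravity z 0 l) =
    (fun v : 'rV[R]_2 => (eucl_norm v ^+ 3)^-1) * (fun v => v 0 l).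
  by rewrite funeqE => z; rewrite /gravity mxE.
apply: is_diff_eq; rewrite funeqE => h.
rewrite /tidal -scalemxAr mulmxBr mulmx1 -scalemxAr mulmxA.
have -> : h *m u^T = (\sum_k u 0 k * h 0 k)%:M.
  rewrite [LHS]mx11_scalar mxE; congr (_%:M); apply: eq_bigr => k _.
  by rewrite mxE mulrC.
rewrite mul_scalar_mx !mxE !fctE /GRing.scale /=; field; exact: lt0r_neq0.
Qed.

(** The linearized force, for tidal matrices [T i j] acting between bodies [i]
    and [j] and centrifugal coefficient [c].  The base ring is arbitrary because
    the map is computed over the reals and diagonalized over the complex
    numbers. *)
Definition restoring (F : comNzRingType) n (c : F) (T : 'I_n -> 'I_n -> 'M[F]_2)
    (x : 'M[F]_(n, 2)) : 'M[F]_(n, 2) :=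
  \matrix_(i < n) (c *: row i x + \sum_(j < n | j != i) (row j x - row i x) *m T i j).

Lemma row_restoring (F : comNzRingType) n (c : F) (T : 'I_n -> 'I_n -> 'M[F]_2) x i :
  row i (restoring c T x) =
    c *: row i x + \sum_(j < n | j != i) (row j x - row i x) *m T i j.
Proof. by rewrite /restoring rowK. Qed.

Lemma restoring_is_linear (F : comNzRingType) n (c : F) (T : 'I_n -> 'I_n -> 'M[F]_2) :
  linear (restoring c T).
Proof.
move=> a x y; apply/row_matrixP => i.
rewrite row_restoring.
have -> : row i (a *: restoring c T x + restoring c T y) =
   a *: row i (restoring c T x) + row i (restoring c T y).
  by rewrite linearP.
have rowP j : row j (a *: x + y) = a *: row j x + row j y by rewrite linearP.
rewrite !row_restoring rowP !scalerDr.
rewrite !scalerA mulrC -!addrA; congr (_ + _).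
rewrite addrCA; congr (_ + _); rewrite scaler_sumr -big_split.
apply: eq_bigr => j _; rewrite rowP opprD addrACA -scalerBr mulmxDl.
by rewrite -scalemxAl.
Qed.

HB.instance Definition _ (F : comNzRingType) n (c : F)
    (T : 'I_n -> 'I_n -> 'M[F]_2) :=
  GRing.isLinear.Build F 'M[F]_(n, 2) 'M[F]_(n, 2) _ (restoring c T)
    (restoring_is_linear c T).

Lemma row_accel (R : realType) (omega : R) x v i :
  row i (accel omega x v) = (2 * omega) *: (row i v *m (Jmx R)^T)
    + omega ^+ 2 *: row i x + \sum_(j < 4 | j != i) gravity (row j x - row i x).
Proof. by rewrite /accel rowK. Qed.

Definition tidal_at (R : realType) (p : phase R) (i j : 'I_4) : 'M[R]_2 :=
  tidal (row j (pos p) - row i (pos p)).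

Definition linearized_accel (R : realType) (omega : R) (p z : phase R) :
    'M[R]_(4, 2) :=
  restoring (omega ^+ 2) (tidal_at p) (pos z)
  + vel z *m ((2 * omega) *: (Jmx R)^T).

Lemma is_diff_accel_row (R : realType) (omega : R) (p : phase R) i :
  @collision_free R p ->
  is_diff p (fun z => row i (accel omega (pos z) (vel z)))
            (fun z => row i (linearized_accel omega p z)).
Proof.
move=> pfree.
have lin_pos : linear (@pos R) by move=> a u v; rewrite /pos !linearP.
have lin_vel : linear (@vel R) by move=> a u v; rewrite /vel !linearP.
pose ri (z : phase R) := row i (pos z).
pose ci (z : phase R) := row i (vel z) *m (Jmx R)^T.
pose sep j (z : phase R) := row j (pos z) - row i (pos z).
have dri : is_diff p ri ri.
  by apply: is_diff_linear => a u v; rewrite /ri lin_pos linearP.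
have dci : is_diff p ci ci.
  apply: is_diff_linear => a u v.
  by rewrite /ci lin_vel linearP /= mulmxDl scalemxAl.
have dsep j : is_diff p (sep j) (sep j).
  apply: is_diff_linear => a u v.
  by rewrite /sep lin_pos; apply/rowP => k; rewrite !mxE; ring.
have dsum : is_diff p (\sum_(j < 4 | j != i) (@gravity R \o sep j))
    (\sum_(j < 4 | j != i) ((fun u => u *m tidal_at p i j) \o sep j)).
  apply: is_diff_bigsum => j ji; apply: is_diff_comp.
  by apply: is_diff_gravity; rewrite subr_eq0 pfree.
have -> : (fun z => row i (accel omega (pos z) (vel z))) =
    (2 * omega) *: ci + omega ^+ 2 *: ri
    + \sum_(j < 4 | j != i) (@gravity R \o sep j).
  by rewrite funeqE => z; rewrite row_accel !fctE fct_sumE.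
have dlin := is_diffD (is_diffZ (2 * omega) dci) (is_diffZ (omega ^+ 2) dri).
apply: (is_diff_eq (is_diffD dlin dsum)).
rewrite funeqE => z; rewrite !fctE fct_sumE /linearized_accel.
rewrite linearD /= row_restoring row_mul -scalemxAr [RHS]addrC addrA.
by congr (_ + _ + _).
Qed.

Lemma is_diff_accel (R : realType) (omega : R) (p : phase R) :
  @collision_free R p ->
  is_diff p (fun z => accel omega (pos z) (vel z)) (linearized_accel omega p).
Proof.
move=> pfree; apply: is_diff_mx => i k.
have entryE (f : phase R -> 'M[R]_(4, 2)) :
    (fun z => f z i k) = (fun z => row i (f z) 0 k).
  by rewrite funeqE => z; rewrite [RHS]mxE.
rewrite (entryE (fun z => accel _ _ _)) entryE.
exact: is_diff_entry (is_diff_accel_row omega i pfree).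
Qed.

Lemma is_diff_state (R : realType) (p : phase R)
    (f df g dg : phase R -> 'M[R]_(4, 2)) :
  is_diff p f df -> is_diff p g dg ->
  is_diff p (fun z => state (f z) (g z)) (fun h => state (df h) (dg h)).
Proof.
have stateEl x v i k :
    @state R x v 0 (lshift (4 * 2) (mxvec_index i k)) = x i k.
  by rewrite row_mxEl mxvecE.
have stateEr x v i k :
    @state R x v 0 (rshift (4 * 2) (mxvec_index i k)) = v i k.
  by rewrite row_mxEr mxvecE.
move=> dfp dgp; apply: is_diff_mx => i0 j; rewrite ord1 {i0}.
case: (split_ordP j) => m -> {j}; case/mxvec_indexP: m => i k.
  under eq_fun do rewrite stateEl; under [X in is_diff _ _ X]eq_fun do rewrite stateEl.
  exact: is_diff_entry.
under eq_fun do rewrite stateEr; under [X in is_diff _ _ X]eq_fun do rewrite stateEr.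
exact: is_diff_entry.
Qed.

Lemma is_diff_rotating_field (R : realType) (omega : R) (p : phase R) :
  @collision_free R p ->
  is_diff p (rotating_field omega)
            (fun z => state (vel z) (linearized_accel omega p z)).
Proof.
move=> pfree; apply: is_diff_state; last exact: is_diff_accel.
by apply: is_diff_linear => a u v; rewrite /vel !linearP.
Qed.

Lemma pos_state (R : realType) (x v : 'M[R]_(4, 2)) : pos (state x v) = x.
Proof. by rewrite /pos /state row_mxKl mxvecK. Qed.

Lemma vel_state (R : realType) (x v : 'M[R]_(4, 2)) : vel (state x v) = v.
Proof. by rewrite /vel /state row_mxKr mxvecK. Qed.

Lemma jacobian_rotating_field (R : realType) (omega : R) (p : phase R) :
  @collision_free R p ->
  jacobian (rotating_field omega) p =
  block_mx 0 (lin_mx (restoring (omega ^+ 2) (tidal_at p)))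
           1%:M (lin_mx (mulmxr ((2 * omega) *: (Jmx R)^T))).
Proof.
move=> pfree; have [_ dF] := is_diff_rotating_field omega pfree.
apply/row_matrixP => i; rewrite !rowE; set u := delta_mx 0 i.
rewrite /jacobian mul_rV_lin1 dF -[u in RHS]hsubmxK mul_row_block mulmx0 add0r mulmx1.
rewrite /linearized_accel /state /pos /vel linearD /= vec_mxK.
by congr (row_mx _ (_ + _)); rewrite mul_rV_lin.
Qed.

(** For the square, the difference of the positions of bodies [i] and [j] is
    determined up to sign by [i + j] modulo 4: it is a diagonal when [i + j] is
    even and a side when it is odd. *)
Definition square_tidal (F : comNzRingType) (a b : F) (i j : 'I_4) : 'M[F]_2 :=
  \matrix_(k < 2, l < 2)
    (nth [::] (nth [::]
      [:: [:: [:: b; 0]; [:: 0; - 2 * b]];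
          [:: [:: - a; 3 * a]; [:: 3 * a; - a]];
          [:: [:: - 2 * b; 0]; [:: 0; b]];
          [:: [:: - a; - 3 * a]; [:: - 3 * a; - a]]] ((i + j) %% 4)) k)`_l.

Lemma square_dist (R : realType) (i j : 'I_4) : i != j ->
  eucl_norm (row j (square R) - row i (square R)) =
    if odd (i + j) then 2 * Num.sqrt 2 else 4.
Proof.
have r2 : Num.sqrt (2 : R) ^+ 2 = 2 by rewrite sqr_sqrtr.
move=> ij; rewrite /eucl_norm -[RHS]ger0_norm; last first.
  by case: ifP => _ //; rewrite mulr_ge0.
rewrite -sqrtr_sqr; congr Num.sqrt; rewrite !big_ord_recl big_ord0 !mxE.
case: ifP; case: i ij => [[|[|[|[|//]]]] ?]; case: j => [[|[|[|[|//]]]] ?] //= _ _;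
  rewrite ?exprMn ?r2; ring.
Qed.

Lemma square_cube_dist (R : realType) (i j : 'I_4) : i != j ->
  (eucl_norm (row j (square R) - row i (square R)) ^+ 3)^-1 =
    if odd (i + j) then Num.sqrt 2 / 32 else 1 / 64.
Proof.
have r2 : Num.sqrt (2 : R) ^+ 2 = 2 by rewrite sqr_sqrtr.
have r0 : Num.sqrt (2 : R) != 0 by rewrite sqrtr_eq0 -ltNge.
move=> ij; rewrite square_dist //; case: ifP => _; last by field.
have rV : (Num.sqrt 2)^-1 = Num.sqrt 2 / 2 :> R.
  by apply: (mulfI r0); rewrite mulfV // mulrA -expr2 r2 mulfV // pnatr_eq0.
rewrite exprSr exprMn r2 !invfM rV; by field.
Qed.

Lemma tidal_square (R : realType) (i j : 'I_4) : i != j ->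
  tidal_at (state (square R) 0) i j = square_tidal (Num.sqrt 2 / 64) (1 / 64) i j.
Proof.
have r2 : Num.sqrt (2 : R) ^+ 2 = 2 by rewrite sqr_sqrtr.
move=> ij; rewrite /tidal_at pos_state /tidal square_cube_dist // square_dist //.
have -> : (if odd (i + j) then 2 * Num.sqrt 2 else 4 : R) ^+ 2 =
    if odd (i + j) then 8 else 16.
  by case: ifP => _; rewrite ?exprMn ?r2; ring.
apply/matrixP => k l; rewrite !mxE big_ord1 !mxE.
case: i ij => [[|[|[|[|//]]]] ?]; case: j => [[|[|[|[|//]]]] ?] //= _;
case: k => [[|[|//]] ?]; case: l => [[|[|//]] ?] /=; by field.
Qed.

(** * Characteristic polynomial of a second-order system *)

Lemma det_mx22 (F : comNzRingType) (A : 'M[F]_2) :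
  \det A = A 0 0 * A 1 1 - A 0 1 * A 1 0.
Proof.
rewrite (expand_det_row _ 0) !big_ord_recl big_ord0 /cofactor !det_mx11 !mxE.
rewrite addr0 expr0 mul1r expr1 mulN1r mulrN.
by congr (_ * A _ _ - A _ _ * A _ _); apply: val_inj.
Qed.

Lemma char_poly_similar (F : fieldType) n (P A B : 'M[F]_n) :
  P \in unitmx -> P *m A = B *m P -> char_poly A = char_poly B.
Proof.
move=> uP PA; pose Pp := map_mx (@polyC F) P.
have dP : \det Pp != 0.
  by rewrite /Pp det_map_mx polyC_eq0 -unitfE -unitmxE.
apply: (mulfI dP); rewrite /char_poly [RHS]mulrC -!det_mulmx.
congr (\det _); rewrite /char_poly_mx mulmxBr mulmxBl scalar_mxC.
by congr (_ - _); rewrite -!map_mxM PA.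
Qed.

(** The quadratic matrix polynomial whose determinant vanishes at [l] when
    [x'' = x K + x' G] has a nonzero solution [exp (l t) v]. *)
Definition pencil (F : comNzRingType) n (K G : 'M[F]_n) : 'M[{poly F}]_n :=
  ('X ^+ 2)%:M - 'X *: map_mx polyC G - map_mx polyC K.

Lemma char_poly_second_order (F : comNzRingType) n (K G : 'M[F]_n) :
  char_poly (block_mx 0 K 1%:M G) = \det (pencil K G).
Proof.
rewrite /char_poly /char_poly_mx map_block_mx map_mx0 map_mx1.
rewrite scalar_mx_block opp_block_mx add_block_mx !oppr0 !addr0 !add0r.
set Kp := map_mx _ K; set Gp := map_mx _ G.
(* This block row operation clears the upper left corner. *)
have := det_mulmx (block_mx 1%:M 'X%:M 0 1%:M)
                  (block_mx 'X%:M (- Kp) (- 1%:M) ('X%:M - Gp)).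
rewrite det_ublock !det1 !mul1r => <-.
rewrite mulmx_block !mul1mx !mul0mx !add0r mulmxN mulmx1 subrr.
have -> : - Kp + 'X%:M *m ('X%:M - Gp) = pencil K G.
  by rewrite /pencil mulmxBr -scalar_mxM mul_scalar_mx -expr2 addrC.
set D := 'X%:M - Gp; set B := pencil K G.
(* A block column swap with a sign, of determinant 1 because it is a product
   of three transvections. *)
have swap : \det (block_mx 0 (- 1%:M) 1%:M 0 : 'M[{poly F}]_(n + n)) = 1.
  pose U : 'M[{poly F}]_(n + n) := block_mx 1%:M (- 1%:M) 0 1%:M.
  pose L : 'M[{poly F}]_(n + n) := block_mx 1%:M 0 1%:M 1%:M.
  have -> : block_mx 0 (- 1%:M) 1%:M 0 = U *m L *m U.
    rewrite /U /L !mulmx_block !(mul1mx, mulmx1, mul0mx, mulmx0, addr0, add0r, subrr).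
    by rewrite addNr.
  by rewrite !det_mulmx !det_ublock det_lblock !det1 !mulr1.
rewrite -[LHS]mulr1 -[X in _ * X = _]swap -det_mulmx mulmx_block.
rewrite !(mulmx1, mul0mx, mulmx0, addr0, add0r).
by rewrite !mulmxN !mulmx1 opprK det_lblock det1 mulr1.
Qed.

Lemma det_pencil_block (F : comNzRingType) m n (K1 G1 : 'M[F]_m) (K2 G2 : 'M[F]_n) :
  \det (pencil (block_mx K1 0 0 K2) (block_mx G1 0 0 G2)) =
  \det (pencil K1 G1) * \det (pencil K2 G2).
Proof.
rewrite -(det_lblock _ 0); congr (\det _); rewrite /pencil !map_block_mx !map_mx0.
rewrite scale_block_mx scalar_mx_block !opp_block_mx !add_block_mx.
by rewrite !scaler0 !oppr0 !addr0.
Qed.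

(** The sizes [m] and [n] are kept apart so that the modal basis [P] may be
    indexed by a block decomposition of the index set of [K]. *)
Lemma char_poly_modal (F : fieldType) m n (K G : 'M[F]_n) (K' G' : 'M[F]_m)
    (P : 'M[F]_(m, n)) :
  m = n -> row_free P -> P *m K = K' *m P -> P *m G = G' *m P ->
  char_poly (block_mx 0 K 1%:M G) = \det (pencil K' G').
Proof.
move=> eq_mn; case: n / eq_mn in K G P *; rewrite row_free_unit => uP PK PG.
rewrite -char_poly_second_order.
apply: (@char_poly_similar _ _ (block_mx P 0 0 P)).
  by rewrite unitmxE det_ublock unitrM -!unitmxE uP.
by rewrite !mulmx_block !(mul1mx, mulmx1, mul0mx, mulmx0, addr0, add0r) PK PG.
Qed.

(** * Symmetry modes of the square *)

(** Row [i] of [mode t e] is [t^i] times the [e]-th basis vector turned by [i]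
    quarter turns. *)
Definition mode (F : comNzRingType) (t : F) (e : 'I_2) : 'M[F]_(4, 2) :=
  \matrix_(i < 4, k < 2)
    (nth [::] (nth [::]
      [:: [:: [:: 1; 0]; [:: 0; t]; [:: - t ^+ 2; 0]; [:: 0; - t ^+ 3]];
          [:: [:: 0; 1]; [:: - t; 0]; [:: 0; - t ^+ 2]; [:: t ^+ 3; 0]]] e) i)`_k.

(** The restriction of the linearized force to the [t]-modes. *)
Definition mode_restoring (F : comNzRingType) (a b t : F) : 'M[F]_2 :=
  \matrix_(k < 2, l < 2) (nth [::]
    [:: [:: 6 * a + 4 * b + 3 * a * (t + t ^+ 3) + 2 * b * t ^+ 2;
            a * (t ^+ 3 - t)];
        [:: a * (t - t ^+ 3);
            6 * a + b - 3 * a * (t + t ^+ 3) - b * t ^+ 2]] k)`_l.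

(** The modes form an eigenspace of the symmetry of the square, with which the
    linearized force commutes.  The coefficient
    [4 a + 2 b] is [omega^2] for [a = sqrt 2 / 64] and [b = 1 / 64]. *)
Lemma restoring_mode (F : comNzRingType) (a b t : F) e : t ^+ 4 = 1 ->
  restoring (4 * a + 2 * b) (square_tidal a b) (mode t e) =
  \sum_e' mode_restoring a b t e e' *: mode t e'.
Proof.
move=> t4; apply/matrixP => i k; rewrite !mxE !summxE !big_ord_recl !big_ord0 !mxE.
rewrite !big_mkcond /= !big_ord_recl !big_ord0 /=.
case: e => [[|[|//]] ?]; case: i => [[|[|[|[|//]]]] ?]; case: k => [[|[|//]] ?] /=;
  rewrite ?addr0 ?mxE ?big_ord_recl ?big_ord0 ?mxE /=.
all: ring: t4.
Qed.

Definition modes (F : comNzRingType) (t : F) : 'M[F]_(2, 4 * 2) :=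
  \matrix_e mxvec (mode t e).

Definition coriolis (F : comNzRingType) (g : F) : 'M[F]_2 :=
  \matrix_(k < 2, l < 2) (nth [::] [:: [:: 0; - g]; [:: g; 0]] k)`_l.

Lemma modes_restoring (F : comNzRingType) (a b t : F) : t ^+ 4 = 1 ->
  modes t *m lin_mx (restoring (4 * a + 2 * b) (square_tidal a b)) =
  mode_restoring a b t *m modes t.
Proof.
move=> t4; apply/row_matrixP => e; rewrite !row_mul rowK mul_vec_lin.
rewrite [_ _ _ (mode t e)]restoring_mode // mulmx_sum_row linear_sum.
by apply: eq_bigr => e' _; rewrite linearZ /= rowK [X in _ = X *: _]mxE.
Qed.

Lemma modes_coriolis (F : comNzRingType) (g t : F) :
  modes t *m lin_mx (mulmxr (coriolis g)) = coriolis g *m modes t.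
Proof.
apply/row_matrixP => e; rewrite !row_mul rowK mul_vec_lin /=.
have -> : mode t e *m coriolis g = \sum_e' coriolis g e e' *: mode t e'.
  apply/matrixP => i k; rewrite !mxE !summxE !big_ord_recl !big_ord0 !mxE.
  case: e => [[|[|//]] ?]; case: i => [[|[|[|[|//]]]] ?];
  case: k => [[|[|//]] ?] /=; ring.
rewrite mulmx_sum_row linear_sum.
by apply: eq_bigr => e' _; rewrite linearZ /= rowK [X in _ = X *: _]mxE.
Qed.

Lemma mxvec_dot (F : comNzRingType) m n (A B : 'M[F]_(m, n)) :
  (mxvec A *m (mxvec B)^T) 0 0 = \sum_i \sum_k A i k * B i k.
Proof.
rewrite mxE (reindex _ (curry_mxvec_bij _ _)) pair_bigA.
by apply: eq_bigr => -[i k] _; rewrite [(_^T) _ _]mxE /= !mxvecE.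
Qed.

(** Orthogonality of the modes: the factor is the geometric sum of the powers of
    [t u], which vanishes when [t] and [u^-1] are distinct fourth roots of 1. *)
Lemma modes_dot (F : comNzRingType) (t u : F) :
  modes t *m (modes u)^T = ((1 + t * u) * (1 + (t * u) ^+ 2))%:M.
Proof.
apply/matrixP => e e'.
have -> : (modes t *m (modes u)^T) e e' = \sum_i \sum_k mode t e i k * mode u e' i k.
  rewrite -mxvec_dot !mxE; apply: eq_bigr => m _.
  by rewrite !mxE.
rewrite !big_ord_recl !big_ord0 !mxE.
case: e => [[|[|//]] ?]; case: e' => [[|[|//]] ?] /=; ring.
Qed.

(** The modes for [1, -1, i, -i] form a basis, with inverse [4^-1 Q^T] by
    [modes_dot]; the order of the last two blocks of [Q] is exchanged because
    [i^-1 = - i]. *)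
Lemma char_poly_square (F : fieldType) (a b g i : F) : i ^+ 2 = -1 -> 2 != 0 :> F ->
  char_poly (block_mx 0 (lin_mx (restoring (4 * a + 2 * b) (square_tidal a b)))
                      1%:M (lin_mx (mulmxr (coriolis g)))) =
  \prod_(t <- [:: 1; -1; i; -i]) \det (pencil (mode_restoring a b t) (coriolis g)).
Proof.
move=> i2 n2.
pose P := col_mx (col_mx (modes 1) (modes (-1))) (col_mx (modes i) (modes (- i))).
pose Q := col_mx (col_mx (modes 1) (modes (-1))) (col_mx (modes (- i)) (modes i)).
have PQ : P *m Q^T = 4%:M.
  rewrite /P /Q !tr_col_mx !mul_col_row !modes_dot.
  have ii : i * i = -1 by rewrite -expr2.
  rewrite !(mulr1, mul1r, mulrN, mulNr, opprK, ii, sqrrN, expr1n, i2).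
  rewrite !(subrr, mul0r, mulr0).
  have -> : (1 + 1) * (1 + 1) = 4 :> F by ring.
  by rewrite !scalar_mx_block !raddf0 block_mx0.
have P_free : row_free P.
  apply/row_freeP; exists (4^-1 *: Q^T); rewrite -scalemxAr PQ scale_scalar_mx mulVf //.
  have -> : 4 = 2 * 2 :> F by ring.
  by rewrite mulf_neq0.
pose diag M : 'M[F]_(2 + 2 + (2 + 2)) :=
  block_mx (block_mx (M 1) 0 0 (M (-1))) 0 0 (block_mx (M i) 0 0 (M (-i))).
rewrite (@char_poly_modal _ (2 + 2 + (2 + 2)) (4 * 2) _ _
  (diag (mode_restoring a b)) (diag (fun=> coriolis g)) P) //.
- by rewrite /diag !det_pencil_block !big_cons big_nil mulr1 -!mulrA.
- rewrite /P /diag !(mul_col_mx, mul_row_col, mul0mx, addr0, add0r).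
  rewrite !modes_restoring //; try by ring: i2.
- rewrite /P /diag !(mul_col_mx, mul_row_col, mul0mx, addr0, add0r).
  by rewrite !modes_coriolis.
Qed.

(** * The eigenvalues of the square *)

Lemma det_pencil_mode (F : comNzRingType) (a b g t : F) (k := mode_restoring a b t) :
  \det (pencil k (coriolis g)) =
  ('X ^+ 2 - (k 0 0)%:P) * ('X ^+ 2 - (k 1 1)%:P)
  + (g%:P * 'X - (k 0 1)%:P) * (g%:P * 'X + (k 1 0)%:P).
Proof.
rewrite det_mx22 /pencil !mxE /= !(mulr1n, mulr0n). ring.
Qed.

Lemma det_pencil_mode1 (F : comNzRingType) (a b w i : F) :
  i ^+ 2 = -1 -> w ^+ 2 = 4 * a + 2 * b ->
  \det (pencil (mode_restoring a b 1) (coriolis (2 * w))) =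
  \prod_(l <- [:: 0; 0; w * i; - (w * i)]) ('X - l%:P).
Proof.
move=> i2 w2; rewrite det_pencil_mode !mxE /= !big_cons big_nil.
have w2P : w%:P ^+ 2 = 4 * a%:P + 2 * b%:P.
  by rewrite -polyC_exp w2; ring.
have i2P : i%:P ^+ 2 = -1 by rewrite -polyC_exp i2; ring.
ring: w2P i2P.
Qed.

Lemma det_pencil_modeN1 (F : comNzRingType) (a b w r s : F) :
  w ^+ 2 = 4 * a + 2 * b ->
  r ^+ 2 + s ^+ 2 = - w ^+ 2 -> r ^+ 2 * s ^+ 2 = 72 * (a * b) ->
  \det (pencil (mode_restoring a b (-1)) (coriolis (2 * w))) =
  \prod_(l <- [:: r; - r; s; - s]) ('X - l%:P).
Proof.
move=> w2 rDs rMs; rewrite det_pencil_mode !mxE /= !big_cons big_nil.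
have w2P : w%:P ^+ 2 = 4 * a%:P + 2 * b%:P.
  by rewrite -polyC_exp w2; ring.
have DP : r%:P ^+ 2 = - 4 * a%:P - 2 * b%:P - s%:P ^+ 2.
  rewrite -polyC_exp; have -> : r ^+ 2 = - 4 * a - 2 * b - s ^+ 2.
    by apply: (addIr (s ^+ 2)); rewrite rDs w2; ring.
  ring.
have MP : r%:P ^+ 2 * s%:P ^+ 2 = 72 * (a%:P * b%:P).
  by rewrite -!polyC_exp -polyCM rMs; ring.
transitivity ('X ^+ 4 + (4 * a%:P + 2 * b%:P) * 'X ^+ 2 + 72 * (a%:P * b%:P)).
  ring: w2P.
rewrite -MP; ring: DP.
Qed.

Lemma det_pencil_modei (F : comNzRingType) (a b w i n : F) :
  i ^+ 2 = -1 -> w ^+ 2 = 4 * a + 2 * b -> n ^+ 2 = 4 * a ->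
  \det (pencil (mode_restoring a b i) (coriolis (2 * w))) =
  \prod_(l <- [:: w * i; w * i; n - w * i; - n - w * i]) ('X - l%:P).
Proof.
move=> i2 w2 n2; rewrite det_pencil_mode !mxE /= !big_cons big_nil.
have w2P : w%:P ^+ 2 = 4 * a%:P + 2 * b%:P.
  by rewrite -polyC_exp w2; ring.
have i2P : i%:P ^+ 2 = -1 by rewrite -polyC_exp i2; ring.
have n2P : n%:P ^+ 2 = 4 * a%:P by rewrite -polyC_exp n2; ring.
ring: w2P i2P n2P.
Qed.

Lemma char_poly_square_split (F : fieldType) (a b w i n r s : F) (m := w * i) :
  2 != 0 :> F -> i ^+ 2 = -1 -> w ^+ 2 = 4 * a + 2 * b -> n ^+ 2 = 4 * a ->
  r ^+ 2 + s ^+ 2 = - w ^+ 2 -> r ^+ 2 * s ^+ 2 = 72 * (a * b) ->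
  char_poly (block_mx 0 (lin_mx (restoring (4 * a + 2 * b) (square_tidal a b)))
                      1%:M (lin_mx (mulmxr (coriolis (2 * w))))) =
  \prod_(l <- [:: 0; 0; m; - m] ++ [:: r; - r; s; - s] ++ [:: m; m; - m; - m]
              ++ [:: n + m; - n + m; n - m; - n - m]) ('X - l%:P).
Proof.
move=> two_neq0 i2 w2 n2 rDs rMs.
have iN2 : (- i) ^+ 2 = -1 by rewrite sqrrN.
rewrite (char_poly_square _ _ _ i2 two_neq0) 4!big_cons big_nil mulr1.
rewrite (det_pencil_mode1 i2 w2) (det_pencil_modeN1 w2 rDs rMs).
rewrite (det_pencil_modei i2 w2 n2) (det_pencil_modei iN2 w2 n2) mulrN opprK -/m.
rewrite -!big_cat; apply: perm_big; rewrite !perm_cat2l.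
apply/permP => q /=; case: (q m); case: (q (- m)); case: (q (n + m));
by case: (q (- n + m)); case: (q (n - m)); case: (q (- n - m)).
Qed.

(** * The Jacobian at the square *)

Lemma map_restoring (F F' : comNzRingType) (f : {rmorphism F -> F'}) n (c : F)
    (T : 'I_n -> 'I_n -> 'M[F]_2) x :
  map_mx f (restoring c T x) = restoring (f c) (fun i j => map_mx f (T i j)) (map_mx f x).
Proof.
apply/row_matrixP => i; rewrite -map_row !row_restoring map_mxD map_mxZ map_row.
congr (_ + _); rewrite raddf_sum; apply: eq_bigr => j _.
by rewrite /= map_mxM map_mxB !map_row.
Qed.

Lemma map_square_tidal (F F' : comNzRingType) (f : {rmorphism F -> F'}) (a b : F) i j :
  map_mx f (square_tidal a b i j) = square_tidal (f a) (f b) i j.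
Proof.
apply/matrixP => k l; rewrite !mxE.
case: i => [[|[|[|[|//]]]] ?]; case: j => [[|[|[|[|//]]]] ?];
case: k => [[|[|//]] ?]; case: l => [[|[|//]] ?] /=;
by rewrite ?rmorph0 ?rmorphM ?rmorphN ?rmorph_nat.
Qed.

Lemma eq_restoring (F : comNzRingType) n (c : F) (T T' : 'I_n -> 'I_n -> 'M[F]_2) :
  (forall i j, i != j -> T i j = T' i j) -> restoring c T =1 restoring c T'.
Proof.
move=> eqT x; apply/row_matrixP => i; rewrite !row_restoring; congr (_ + _).
by apply: eq_bigr => j ji; rewrite eqT // eq_sym.
Qed.

Lemma square_collision_free (R : realType) : @collision_free R (state (square R) 0).
Proof.
move=> i j ij; rewrite pos_state eq_sym -subr_eq0; apply/eqP => d0.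
have := square_dist R ij; rewrite d0 /eucl_norm big1 => [|k _]; last first.
  by rewrite mxE expr0n.
rewrite sqrtr0; case: ifP => _ /eqP; rewrite eq_sym ?mulf_eq0 ?sqrtr_eq0 ?pnatr_eq0 //=.
by rewrite -[_ <= _]negbK -ltNge ltr0n.
Qed.

Lemma complex_jacobian_square (R : realType) (omega : R) (a b : R[i]) :
  a = (Num.sqrt 2 / 64)%:C -> b = (1 / 64)%:C ->
  omega ^+ 2 = Num.sqrt 2 / 16 + 1 / 32 ->
  map_mx (real_complex R) (jacobian (rotating_field omega) (state (square R) 0)) =
  block_mx 0 (lin_mx (restoring (4 * a + 2 * b) (square_tidal a b)))
           1%:M (lin_mx (mulmxr (coriolis (2 * omega%:C)))).
Proof.
move=> aE bE omega2; rewrite (jacobian_rotating_field _ (@square_collision_free R)).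
rewrite map_block_mx map_mx0 map_mx1; congr (block_mx _ _ _ _).
  apply: map_lin_mx => x; rewrite map_restoring /=.
  rewrite [X in restoring X](_ : _ = 4 * a + 2 * b); last first.
    have c4 : 4 = (4 : R)%:C :> R[i] by rewrite rmorph_nat.
    have c2 : 2 = (2 : R)%:C :> R[i] by rewrite rmorph_nat.
    by rewrite omega2 aE bE c4 c2 -!rmorphM -rmorphD; congr (_%:C); by field.
  apply: eq_restoring => i j ij.
  by rewrite (tidal_square R ij) map_square_tidal aE bE.
apply: map_lin_mx => x; rewrite /= map_mxM; congr (_ *m _).
apply/matrixP => k l; rewrite !mxE.
have -> : 2 * omega%:C = (2 * omega)%:C by rewrite rmorphM rmorph_nat.
case: k => [[|[|//]] ?]; case: l => [[|[|//]] ?] /=;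
by rewrite ?subr0 ?sub0r ?subrr ?mulr1 ?mulr0 ?mulrN1 ?rmorphN ?rmorph0.
Qed.

Lemma rotating_field_square (R : realType) (omega : R) :
  omega ^+ 2 = Num.sqrt 2 / 16 + 1 / 32 ->
  rotating_field omega (state (square R) 0) = 0.
Proof.
move=> omega2; rewrite /rotating_field pos_state vel_state.
have -> : accel omega (square R) 0 = 0.
  apply/row_matrixP => i; rewrite row_accel !row0 mul0mx scaler0 add0r.
  have -> : \sum_(j < 4 | j != i) gravity (row j (square R) - row i (square R)) =
      \sum_(j < 4 | j != i) (if odd (i + j) then Num.sqrt 2 / 32 else 1 / 64)
        *: (row j (square R) - row i (square R)).
    by apply: eq_bigr => j ji; rewrite /gravity square_cube_dist // eq_sym.
  rewrite omega2; apply/rowP => k.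
  rewrite !mxE summxE big_mkcond !big_ord_recl big_ord0 !mxE.
  case: i => [[|[|[|[|//]]]] ?]; case: k => [[|[|//]] ?] /=; rewrite ?mxE /=; by field.
by rewrite /state !linear0 row_mx0.
Qed.

Lemma Re_neq0_of_sqr (R : realType) (z : R[i]) :
  complex.Im (z ^+ 2) != 0 -> complex.Re z != 0.
Proof.
apply: contra => /eqP; case: z => x y; rewrite expr2 /= => ->.
by rewrite mul0r mulr0 addr0.
Qed.

(** The list of eigenvalues is determined up to order by the characteristic
    polynomial. *)
Lemma count_eigenvalues (R : realType) n (A : 'M[R]_n) (s t : seq R[i]) p :
  has_eigenvalues A s -> has_eigenvalues A t -> count p s = count p t.
Proof.
rewrite /has_eigenvalues => -> /prod_XsubC_eq /permP; exact.
Qed.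

Unset Implicit Arguments.
Set Strict Implicit.

Theorem mainTheorem4 (R : realType) (omega : R)
    (omega_gt0 : 0 < omega)
    (omega_sqr : omega ^+ 2 = Num.sqrt 2 / 16 + 1 / 32) :
  let F := rotating_field omega in
  let p := state (square R) 0 in
  let mu : R[i] := (Num.sqrt (2 + 4 * Num.sqrt 2) / 8)%:C * 'i in
  let nu : R[i] := (2 `^ (1 / 4) / 4)%:C in
  let wp : R[i] :=
    'i * (Num.sqrt (68 * Num.sqrt 2 - 9))%:C - (2 * Num.sqrt 2)%:C - 1 in
  let wm : R[i] :=
    - 'i * (Num.sqrt (68 * Num.sqrt 2 - 9))%:C - (2 * Num.sqrt 2)%:C - 1 in
  let eigs_i := [:: 0; 0; mu; - mu] in
  let eigs_ii := [:: 1 / 8 * sqrtc wp; - (1 / 8 * sqrtc wp);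
                     1 / 8 * sqrtc wm; - (1 / 8 * sqrtc wm)] in
  let eigs_iii := [:: mu; mu; - mu; - mu] in
  let eigs_iv := [:: nu + mu; - nu + mu; nu - mu; - nu - mu] in
  let eigs := eigs_i ++ eigs_ii ++ eigs_iii ++ eigs_iv in
  [/\ collision_free p /\ F p = 0,
      differentiable F p,
      has_eigenvalues (jacobian F p) eigs,
      (forall l, l \in eigs_ii ++ eigs_iv -> complex.Re l != 0)
      /\ (forall s, has_eigenvalues (jacobian F p) s ->
            count (fun l => (l != 0) && purely_imaginary l) s = 6%N)
    & unstable (@collision_free R) F p].
Proof.
move=> F p mu nu wp wm eigs_i eigs_ii eigs_iii eigs_iv eigs.
set r := Num.sqrt (2 : R).
have r2 : r ^+ 2 = 2 by rewrite sqr_sqrtr.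
have r1 : 1 < r by rewrite -sqrtr1 ltr_sqrt // ltr1n.
pose v := Num.sqrt (68 * r - 9).
have v2 : v ^+ 2 = 68 * r - 9 by rewrite sqr_sqrtr //; lra.
have v0 : v != 0 by rewrite sqrtr_eq0 -ltNge; lra.
have muE : mu = omega%:C * 'i.
  have muR : Num.sqrt (2 + 4 * r) / 8 = omega.
    apply/eqP; rewrite -(@eqrXn2 _ 2) ?divr_ge0 ?sqrtr_ge0 // ?ltW //.
    rewrite expr_div_n sqr_sqrtr ?omega_sqr -/r; last by lra.
    by apply/eqP; field.
  by rewrite /mu -/r muR.
have nu_gt0 : 0 < 2 `^ (1 / 4) / 4 :> R by rewrite divr_gt0 // powR_gt0.
(* a and b stay abstract: the factorization only uses their relations to
   omega and nu. *)
have [a aE] : exists a : R[i], a = (r / 64)%:C by exists (r / 64)%:C.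
have [b bE] : exists b : R[i], b = (1 / 64)%:C by exists (1 / 64)%:C.
have nat_c k : k%:R = (k%:R : R)%:C :> R[i] by rewrite rmorph_nat.
have nu2 : nu ^+ 2 = 4 * a.
  rewrite /nu aE (nat_c 4%N) -rmorphXn -rmorphM /=; congr (_%:C); rewrite expr_div_n.
  rewrite -powR_mulrn ?powR_ge0 // -powRrM.
  have -> : 1 / 4 * 2%:R = 2^-1 :> R by field.
  by rewrite powR12_sqrt // -/r; field.
have om2 : omega%:C ^+ 2 = 4 * a + 2 * b.
  rewrite aE bE (nat_c 4%N) (nat_c 2%N) -rmorphXn -!rmorphM -rmorphD omega_sqr -/r /=.
  by congr (_%:C); field.
have n2 : 2 != 0 :> R[i] by rewrite pnatr_eq0.
have sqrE (w : R[i]) : (1 / 8 * sqrtc w) ^+ 2 = w / 64.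
  by rewrite exprMn sqr_sqrtc; field.
have wpE : wp = (- 2 * r - 1) +i* v.
  apply/eqP; rewrite eq_complex /= -/r -/v; apply/andP; split; apply/eqP; ring.
have wmE : wm = (- 2 * r - 1) -i* v.
  apply/eqP; rewrite eq_complex /= -/r -/v; apply/andP; split; apply/eqP; ring.
have i2 : 'i ^+ 2 = -1 :> R[i] := sqr_i R.
have rc2 : r%:C ^+ 2 = 2 :> R[i] by rewrite -rmorphXn r2 rmorph_nat.
have vc2 : v%:C ^+ 2 = 68 * r%:C - 9 :> R[i].
  by rewrite -rmorphXn v2 rmorphB rmorphM !rmorph_nat.
have aC : a = r%:C / 64 by rewrite aE rmorphM fmorphV rmorph_nat.
have bC : b = 1 / 64 by rewrite bE rmorphM fmorphV rmorph_nat rmorph1.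
have wpC : wp = 'i * v%:C - 2 * r%:C - 1 by rewrite (nat_c 2%N) -rmorphM.
have wmC : wm = - 'i * v%:C - 2 * r%:C - 1 by rewrite (nat_c 2%N) -rmorphM.
have eigP : has_eigenvalues (jacobian F p) eigs.
  rewrite /has_eigenvalues (complex_jacobian_square aE bE omega_sqr).
  rewrite (@char_poly_square_split _ a b omega%:C 'i nu
    (1 / 8 * sqrtc wp) (1 / 8 * sqrtc wm)) //.
  - by rewrite -muE.
  - rewrite !sqrE wpC wmC om2 aC bC; by field.
  - rewrite !sqrE wpC wmC aC bC; by field: rc2 vc2 i2.
have Re_nu : complex.Re nu != 0 by rewrite /= gt_eqF.
have Re_mu : complex.Re mu = 0 by rewrite /mu /= mulr0 mul0r subrr.
have mu0 : mu != 0.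
  rewrite muE mulf_neq0 //; last by rewrite -sqrf_eq0 i2 oppr_eq0 oner_eq0.
  by rewrite fmorph_eq0 gt_eqF.
have ReND (x : R[i]) (y : R[i]) : complex.Re (x + y) = complex.Re x + complex.Re y.
  by case: x y => ? ? [].
have ReN (x : R[i]) : complex.Re (- x) = - complex.Re x.
  by case: x.
(* Each w has nonzero imaginary part, so its square roots are off the imaginary
   axis; the real parts in eigs_iv are those of +-nu. *)
have hyp l : l \in eigs_ii ++ eigs_iv -> complex.Re l != 0.
  rewrite mem_cat => /orP[].
    have Re_ii (w : R[i]) : complex.Im w != 0 -> complex.Re (1 / 8 * sqrtc w) != 0.
      move=> w0; apply: Re_neq0_of_sqr; rewrite sqrE.
      have -> : 64^-1 = (64^-1)%:C :> R[i] by rewrite fmorphV rmorph_nat.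
      by case: w w0 => x y /= y0; rewrite mulr0 add0r mulf_neq0 ?invr_eq0 ?pnatr_eq0.
    have wp0 : complex.Im wp != 0 by rewrite wpE.
    have wm0 : complex.Im wm != 0 by rewrite wmE /= oppr_eq0.
    by rewrite !inE => /or4P[] /eqP ->; rewrite ?ReN ?oppr_eq0 Re_ii.
  by rewrite !inE => /or4P[] /eqP ->; rewrite ReND ?ReN Re_mu ?oppr0 addr0 ?oppr_eq0.
split=> //.
- split; [exact: square_collision_free|exact: rotating_field_square].
- by have [] := is_diff_rotating_field omega (@square_collision_free R).
- split=> // s sP; rewrite (count_eigenvalues _ sP eigP).
  pose c := fun l : R[i] => (l != 0) && purely_imaginary l.
  have c_hyp l : l \in eigs_ii ++ eigs_iv -> c l = false.
    by move=> /hyp /negbTE; rewrite /c /purely_imaginary andbC => ->.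
  have c_mu : c mu by rewrite /c mu0 /purely_imaginary Re_mu eqxx.
  have c_Nmu : c (- mu) by rewrite /c oppr_eq0 mu0 /purely_imaginary ReN Re_mu oppr0 eqxx.
  have c0 : c 0 = false by rewrite /c eqxx.
  rewrite !count_cat -/c.
  have -> : count c eigs_ii = 0%N.
    apply/eqP; rewrite eqn0Ngt -has_count; apply/hasPn => l lii.
    by rewrite c_hyp // mem_cat lii.
  have -> : count c eigs_iv = 0%N.
    apply/eqP; rewrite eqn0Ngt -has_count; apply/hasPn => l liv.
    by rewrite c_hyp // mem_cat liv orbT.
  by rewrite /= c0 c_mu c_Nmu.
- apply: (@unstable_of_eigenvalue _ _ _ _ _ (nu + mu)).
  + exact: rotating_field_square.
  + by have [] := is_diff_rotating_field omega (@square_collision_free R).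
  + by rewrite eigenvalue_root_char eigP root_prod_XsubC !mem_cat !inE eqxx !orbT.
  + by rewrite ReND Re_mu addr0.
Qed.
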